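(* Let $\mathrm{ex}^{\mathrm{lin}}_3(n, C_4)$ denote the maximum number of hyperedges in a $3$-uniform linear hypergraph on $n$ vertices that contains no (Berge) cycle $C_4$ of length $4$. Then $$\mathrm{ex}^{\mathrm{lin}}_3(n, C_4) \le \frac{1}{6}\, n\sqrt{n+9} + \frac{n}{2} = \frac{n^{3/2}}{6} + O(n).$$
   Context: A hypergraph $H=(V,E)$ is $3$-uniform if every hyperedge is a $3$-element subset of $V$, and linear if any two distinct hyperedges share at most one vertex. A (Berge) cycle of length $k\ge 2$ in $H$ is an alternating sequence $v_1,h_1,v_2,h_2,\dots,v_k,h_k$ of distinct vertices $v_i$ and distinct hyperedges $h_i$ such that $v_i,v_{i+1}\in h_i$ for $1\le i\le k-1$ and $v_k,v_1\in h_k$. $H$ contains no $C_4$ means $H$ has no Berge cycle of length $4$. *)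

(* Defs.v *)
From mathcomp Require Import all_boot.

Set Implicit Arguments.
Unset Strict Implicit.
Unset Printing Implicit Defensive.

(* A hypergraph on the finite vertex type V is its set of hyperedges
   H : {set {set V}}. *)

Definition uniform (r : nat) (V : finType) (H : {set {set V}}) : bool :=
  [forall e in H, #|e| == r].

Definition linear_hypergraph (V : finType) (H : {set {set V}}) : bool :=
  [forall e in H, forall f in H, (e != f) ==> (#|e :&: f| <= 1)].

(* Indices live in 'I_k and ordS is the cyclic successor, so the last clause
   also says that v_k and v_1 lie in h_k. *)
Definition is_berge_cycle (V : finType) (H : {set {set V}}) (k : nat)
    (v : {ffun 'I_k -> V}) (h : {ffun 'I_k -> {set V}}) : bool :=
  [&& 1 < k, injectiveb v, injectiveb h &
      [forall i, [&& h i \in H, v i \in h i & v (ordS i) \in h i]]].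

Definition has_berge_cycle (k : nat) (V : finType) (H : {set {set V}}) : bool :=
  [exists v : {ffun 'I_k -> V}, exists h : {ffun 'I_k -> {set V}},
     is_berge_cycle H v h].

(* The maximum is over hypergraphs on the vertex set 'I_n. *)
Definition ex_lin (r k n : nat) : nat :=
  \max_(H : {set {set 'I_n}} | [&& uniform r H, linear_hypergraph H &
                                   ~~ has_berge_cycle k H]) #|H|.

(* Main.v *)
(* Count walks v -e- w -f- u along two distinct hyperedges. Summed over the
   middle vertex w there are 4 d(w) (d(w) - 1) of them. From a fixed v, each u is
   reached through a unique w, except that every flag (e, w) at v admits at most
   4 ambiguous continuations (f, u): without a Berge C4, an ambiguous walk
   makes a triangle with e, based either at w and the third vertex of e, or at w
   and v, and two vertices of e have at most two apexes. Hence, with m = |H|,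
   4 sum_w d(w) (d(w) - 1) <= n^2 + 24 m, and Cauchy-Schwarz together with
   sum_w d(w) = 3 m gives 36 m^2 <= n (n^2 + 36 m). *)
Require Import Defs.
From mathcomp Require Import all_boot all_order all_algebra zify.

(** * Two counting facts independent of hypergraphs *)

Lemma four_notin_triple {V : finType} {e : {set V}} {a b c d : V} :
  #|e| = 3 -> a \in e -> b \in e -> c \in e -> d \in e ->
  ~~ uniq [:: a; b; c; d].
Proof.
move=> e3 ae be ce de; apply/negP => /card_uniqP /= u4.
suff : #|[:: a; b; c; d]| <= #|e| by rewrite u4 e3.
by apply/subset_leq_card/subsetP => x; rewrite !inE => /or4P[] /eqP->.
Qed.

(** Sum [2 * (d i * d j) <= d i ^ 2 + d j ^ 2] over all ordered pairs; this keeps Cauchy-Schwarz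
    inside [nat]. *)
Lemma cauchy_sum_nat {I : finType} (d : I -> nat) :
  (\sum_i d i) ^ 2 <= #|I| * \sum_i d i ^ 2.
Proof.
rewrite -(leq_pmul2l (isT : 0 < 2)) -mulnn big_distrlr /= big_distrr /=.
have -> : 2 * (#|I| * \sum_i d i ^ 2) = \sum_i \sum_j (d i ^ 2 + d j ^ 2).
  under [RHS]eq_bigr => i _ do rewrite big_split /= sum_nat_const.
  by rewrite big_split /= sum_nat_const -big_distrr /= mul2n addnn.
apply: leq_sum => i _; rewrite big_distrr; apply: leq_sum => j _ /=.
by case: (nat_Cauchy (d i) (d j)).
Qed.

(** * Elementary consequences of uniformity, linearity and the absence of a Berge [C4] *)

Section BergeC4Free.
Set Implicit Arguments.
Unset Strict Implicit.
Unset Printing Implicit Defensive.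

Context {V : finType} {H : {set {set V}}}.

Definition deg w := #|[set e in H | w \in e]|.

Hypothesis unif : uniform 3 H.
Hypothesis lin : linear_hypergraph H.
Hypothesis c4free : ~~ has_berge_cycle 4 H.

Lemma uniform_card e : e \in H -> #|e| = 3.
Proof. by move=> eH; apply/eqP; move/forall_inP: unif; apply. Qed.

Lemma card_D1 e w : e \in H -> w \in e -> #|e :\ w| = 2.
Proof. by move=> eH we; have := uniform_card eH; rewrite (cardsD1 w) we => -[]. Qed.

Lemma cards1_D2 e v w : e \in H -> v \in e -> w \in e -> w != v ->
  exists x, e :\ v :\ w = [set x].
Proof.
move=> eH ve we wv; apply/cards1P; have := card_D1 eH ve.
by rewrite (cardsD1 w) !inE wv we => -[/eqP].
Qed.

Lemma linear_eq e f x y : e \in H -> f \in H -> x != y ->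
  x \in e -> y \in e -> x \in f -> y \in f -> e = f.
Proof.
move=> eH fH xy xe ye xf yf; apply/eqP/negPn/negP => ef.
have := implyP (forall_inP (forall_inP lin _ eH) _ fH) ef.
rewrite leqNgt => /negP; apply; apply/card_gt1P; exists x, y.
by rewrite !inE xe ye xf yf.
Qed.

Lemma no_berge_C4 (a b c d : V) (e1 e2 e3 e4 : {set V}) :
  uniq [:: a; b; c; d] -> uniq [:: e1; e2; e3; e4] ->
  [/\ e1 \in H, e2 \in H, e3 \in H & e4 \in H] ->
  [/\ a \in e1, b \in e2, c \in e3 & d \in e4] ->
  [/\ b \in e1, c \in e2, d \in e3 & a \in e4] -> False.
Proof.
move=> ua ue [h1 h2 h3 h4] [i1 i2 i3 i4] [j1 j2 j3 j4].
move/negP: c4free; apply; apply/existsP.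
exists [ffun i : 'I_4 => nth a [:: a; b; c; d] i].
apply/existsP; exists [ffun i : 'I_4 => nth e1 [:: e1; e2; e3; e4] i].
apply/and4P; split=> //.
- apply/injectiveP => i j; rewrite !ffunE => /eqP.
  by rewrite nth_uniq //= => /eqP /val_inj.
- apply/injectiveP => i j; rewrite !ffunE => /eqP.
  by rewrite nth_uniq //= => /eqP /val_inj.
- by apply/forallP => -[[|[|[|[|//]]]] ?]; rewrite !ffunE /=; apply/and3P.
Qed.

(** * Triangles based on two vertices of a hyperedge *)

(** The third corners of triangles with base [e]. For distinct [p], [q] in a hyperedge [e] of [H],
    linearity forces the two other sides to differ and the apex to lie outside [e]. *)
Definition apexes (e : {set V}) (p q : V) :=
  [set x in [predC [set p; q]] |
    [exists f in H :\ e, (p \in f) && (x \in f)] &&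
    [exists g in H :\ e, (q \in g) && (x \in g)]].

(* Otherwise three apexes [x i], witnessed by [f i] through [p] and [g i]
   through [q], pairwise agree in [f] or in [g] (else [p, x i, q, x j] spans a
   Berge [C4]); so all three agree in one of them, giving a hyperedge with four
   vertices. *)
Lemma card_apexes e p q : e \in H -> p != q -> p \in e -> q \in e ->
  #|apexes e p q| <= 2.
Proof.
move=> eH pq pe qe; rewrite leqNgt; apply/negP => /card_gt2P.
case=> x [y [z [[]]]].
have apexP u : u \in apexes e p q -> exists f g,
    [/\ f \in H, g \in H, f != e & g != e] /\
    [/\ p \in f, u \in f, q \in g & u \in g] /\ u != p /\ u != q.
  rewrite !inE negb_or => /andP[/andP[up uq]] /andP[].
  case/exists_inP=> f; rewrite !inE => /andP[fe fH] /andP[pf uf].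
  case/exists_inP=> g; rewrite !inE => /andP[ge gH] /andP[qg ug].
  by exists f, g.
have step u u' f f' g g' : u != u' ->
    [/\ f \in H, g \in H, f != e & g != e] /\
    [/\ p \in f, u \in f, q \in g & u \in g] /\ u != p /\ u != q ->
    [/\ f' \in H, g' \in H, f' != e & g' != e] /\
    [/\ p \in f', u' \in f', q \in g' & u' \in g'] /\ u' != p /\ u' != q ->
    (f == f') || (g == g').
  move=> uu' [[fH gH fe ge] [[pf uf qg ug] [up uq]]].
  move=> [[fH' gH' fe' ge'] [[pf' uf' qg' ug'] [up' uq']]].
  (* A hyperedge through both [p] and [q] is [e] itself, so a side at [p] is never a side at [q]. *)
  have cross h k : h \in H -> k \in H -> h != e -> p \in h -> q \in k -> h != k.
    move=> hH kH he ph qk; apply: contra_neq he => hk.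
    by apply: (linear_eq _ _ pq); rewrite // hk.
  case: (eqVneq f f') => //= ff'; case: (eqVneq g g') => //= gg'; exfalso.
  apply: (@no_berge_C4 p u q u' f g g' f') => //=.
    rewrite !inE !negb_or (eq_sym p) up pq (eq_sym p) up' uq uu' /=.
    by rewrite eq_sym uq'.
  have [fg fg' f'g f'g'] : [/\ f != g, f != g', f' != g & f' != g'].
    by split; apply: cross.
  by rewrite !inE !negb_or fg fg' ff' gg' (eq_sym g f') f'g eq_sym f'g'.
move=> /apexP[f1 [g1 P1]] /apexP[f2 [g2 P2]] /apexP[f3 [g3 P3]] [xy yz zx].
have four h r : h \in H -> x != r /\ y != r /\ z != r ->
    r \in h -> x \in h -> y \in h -> z \in h -> False.
  move=> hH [xr [yr zr]] rh xh yh zh.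
  have := four_notin_triple (uniform_card hH) rh xh yh zh.
  by rewrite /= !inE !(eq_sym r) !negb_or (negPf xr) (negPf yr) (negPf zr)
       (negPf xy) (negPf yz) (eq_sym x) (negPf zx).
have := step _ _ _ _ _ _ xy P1 P2; have := step _ _ _ _ _ _ yz P2 P3.
have := step _ _ _ _ _ _ zx P3 P1.
case: P1 P2 P3 => [[f1H g1H _ _] [[pf1 xf qg1 xg] [xp xq]]].
move=> [_ [[_ yf _ yg] [yp yq]]] [_ [[_ zf _ zg] [zp zq]]].
have allf : f1 = f2 -> f1 = f3 -> False.
  by move=> e2 e3; apply: (four f1 p); rewrite // ?e2 // -e2 e3.
have allg : g1 = g2 -> g1 = g3 -> False.
  by move=> e2 e3; apply: (four g1 q); rewrite // ?e2 // -e2 e3.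
(* Of the three alternatives, two fall on the same side, and two equalities already link all three
   hyperedges. *)
case/orP=> /eqP E1; case/orP=> /eqP E2; case/orP=> /eqP E3;
  by [apply: allf; congruence | apply: allg; congruence].
Qed.

(** * Walks along two hyperedges, and bounding those that share an end *)

(* [((e, w), (f, u))] encodes the walk v -e- w -f- u. *)
Definition walks v : {set ({set V} * V) * ({set V} * V)} :=
  [set q | let: ((e, w), (f, u)) := q in
    [&& [&& e \in H, f \in H & f != e], [&& v \in e, w \in e & v != w] &
        [&& w \in f, u \in f & u != w]]].

Lemma walksP v e w f u :
  reflect ([/\ e \in H, f \in H & f != e] /\ [/\ v \in e, w \in e & v != w] /\
           [/\ w \in f, u \in f & u != w])
          (((e, w), (f, u)) \in walks v).
Proof.
rewrite inE; apply: (iffP and3P) => [[] /and3P ? /and3P ? /and3P ?|] //.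
by move=> [/and3P ? [/and3P ? /and3P ?]].
Qed.

Definition ambiguous v : {set ({set V} * V) * ({set V} * V)} :=
  [set q in walks v | [exists r in walks v,
     (q.2.2 == r.2.2) && (q.1.2 != r.1.2)]].

Definition flags v : {set {set V} * V} :=
  [set p | let: (e, w) := p in [&& e \in H, v \in e, w \in e & v != w]].

(** Compare with a walk v -e'- w' -f'- u where [w' != w]. If [e = e'], then [e], [f], [f'] form a
    triangle with apex [u]; if [f = f'], then [e], [f], [e'] form one with apex [w']; otherwise [v],
    [w], [u], [w'] span a Berge [C4]. *)
Lemma ambiguous_apex v e w f u : ((e, w), (f, u)) \in ambiguous v ->
  (exists2 w', w' \in e :\ v :\ w & u \in apexes e w w') \/
  (exists2 w', w' \in apexes e w v & w' \in f :\ w :\ u).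
Proof.
rewrite inE => /andP[/walksP[[eH fH fe] [[ve we vw] [wf uf uw]]]].
case/exists_inP=> -[[e' w'] [f' u']] /walksP[[eH' fH' fe'] [[ve' we' vw']]].
case=> wf' uf' uw' /= /andP[/eqP uu' ww']; subst u'.
(* Each of [u = v], [e = f'] and [f = e'] would put [v] and a middle vertex into both hyperedges of
   one walk, against linearity. *)
have uv : u != v.
  apply: contra_neq fe => uv; subst u.
  by apply: (linear_eq _ _ vw).
have ef' : e != f'.
  apply: contra_neq fe' => ef'; subst f'.
  by apply: (linear_eq _ _ vw').
have fe2 : f != e'.
  apply: contra_neq fe => fe2; subst f.
  by apply: (linear_eq _ _ vw).
case: (eqVneq e e') => [ee'|ee'].
  subst e'; left; exists w'; first by rewrite !inE eq_sym ww' eq_sym vw'.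
  rewrite !inE negb_or uw uw' /=; apply/andP; split; apply/exists_inP.
    by exists f; rewrite ?inE ?fe ?wf.
  by exists f'; rewrite ?inE ?fe' ?wf'.
case: (eqVneq f f') => [ff'|ff'].
  subst f'; right; exists w'; last by rewrite !inE (eq_sym w') uw' eq_sym ww'.
  rewrite !inE negb_or (eq_sym w') ww' (eq_sym w') vw' /=.
  apply/andP; split; apply/exists_inP; first by exists f; rewrite ?inE ?fe ?wf.
  by exists e'; rewrite ?inE 1?eq_sym ?ee' ?ve'.
exfalso; apply: (@no_berge_C4 v w u w' e f f' e') => //=.
  by rewrite !inE !negb_or vw (eq_sym v) uv vw' (eq_sym w) uw ww' uw'.
by rewrite !inE !negb_or eq_sym fe ef' ee' ff' fe2 fe'.
Qed.

(** Each of the two triangle types accounts for at most two continuations, since each continuation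
    is determined by its apex. *)
Lemma card_ambiguous_fiber v e w : e \in H -> v \in e -> w \in e -> v != w ->
  #|[set p | ((e, w), p) \in ambiguous v]| <= 4.
Proof.
move=> eH ve we vw.
have walkP p : ((e, w), p) \in ambiguous v ->
    [/\ p.1 \in H, w \in p.1, p.2 \in p.1 & p.2 != w].
  by case: p => f u; rewrite inE => /andP[/walksP[[_ fH _] [_ []]]].
have [w' ew'] : exists w', e :\ v :\ w = [set w'].
  by apply: cards1_D2; rewrite // eq_sym.
have w'e : w' \in e :\ v :\ w by rewrite ew' set11.
pose S := [set p | ((e, w), p) \in ambiguous v].
pose S1 := [set p in S | p.2 \in apexes e w w'].
pose S2 := [set p in S |
  [exists x, (x \in apexes e w v) && (x \in p.1 :\ w :\ p.2)]].
suff [c1 c2] : #|S1| <= 2 /\ #|S2| <= 2.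
  have /subset_leq_card : S \subset S1 :|: S2.
    apply/subsetP => -[f u] Sp; have := Sp; rewrite inE => /ambiguous_apex.
    rewrite in_setU => -[] [x x1 x2]; apply/orP; [left | right]; rewrite inE Sp /=.
      by move: x1; rewrite ew' inE => /eqP <-.
    by apply/existsP; exists x; rewrite x1.
  by move/leq_trans; apply; apply: leq_trans (leq_card_setU _ _) (leq_add c1 c2).
have SP p : p \in S -> [/\ p.1 \in H, w \in p.1, p.2 \in p.1 & p.2 != w].
  by rewrite inE => /walkP.
move: w'e; rewrite !inE => /and3P[w'w w'v w'e]; split.
  (* In [S1] the apex is the end of the walk, and it determines the second hyperedge, which also
     contains [w]. *)
  rewrite -(@card_in_imset _ _ (@snd {set V} V)) => [|p q].
    apply: leq_trans (card_apexes eH _ we w'e); last by rewrite eq_sym.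
    apply/subset_leq_card/subsetP => _ /imsetP[p pS1 ->].
    by move: pS1; rewrite inE => /andP[].
  rewrite inE => /andP[/SP[pH wp pp pw] _].
  rewrite inE => /andP[/SP[qH wq qp qw] _] pq.
  case: p q pH wp pp pw qH wq qp qw pq => [f u] [g x] /= *; subst x.
  by congr pair; apply: (@linear_eq _ _ u w).
(* In [S2] the apex is the third vertex of the second hyperedge. With [w] it determines that
   hyperedge, and the end is the vertex left over. Keeping the apex as a singleton avoids choosing
   it. *)
pose g (p : {set V} * V) := p.1 :\ w :\ p.2.
have S2P p : p \in S2 -> exists2 x, x \in apexes e w v & g p = [set x].
  rewrite inE => /andP[/SP[pH wp pp pw]] /existsP[x /andP[xa xp]].
  exists x => //; have [y gy] := cards1_D2 pH wp pp pw.
  by move: xp; rewrite /g gy inE => /eqP ->.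
rewrite -(@card_in_imset _ _ g) => [|p q Sp Sq].
  apply: leq_trans (card_apexes eH _ we ve); last by rewrite eq_sym.
  rewrite -(card_imset (mem (apexes e w v)) (@set1_inj V)).
  apply/subset_leq_card/subsetP => _ /imsetP[p /S2P[x xa ->] ->].
  exact: imset_f.
have [x _ gp] := S2P _ Sp => gpq.
have : x \in g q by rewrite -gpq gp set11.
have : x \in g p by rewrite gp set11.
rewrite !in_setD1 => /and3P[_ xw xp] /and3P[_ _ xq].
move: Sp Sq; rewrite [p \in S2]inE [q \in S2]inE.
move=> /andP[/SP[pH wp pp pw] _] /andP[/SP[qH wq qp qw] _].
have pq1 : p.1 = q.1 by apply: (linear_eq _ _ xw).
apply/eqP; rewrite -pair_eqE /= pq1 eqxx /=; apply/negPn/negP => pq2.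
have : p.2 \in g q by rewrite !inE pq2 pw -pq1.
by rewrite -gpq !inE eqxx.
Qed.

(** An unambiguous walk is determined by its end: the end fixes [w], and linearity then recovers [e]
    from [v], [w] and [f] from [w], [u]. The ambiguous walks are grouped by their first step, a
    flag. *)
Lemma card_walks_le v : #|walks v| <= #|V| + 4 * #|flags v|.
Proof.
rewrite -(cardsID (ambiguous v)) addnC; apply: leq_add.
  apply: (@leq_card_in _ _ (fun q => q.2.2)) => q r.
  rewrite !in_setD => /andP[qa qw] /andP[ra rw] qr.
  have qr1 : q.1.2 = r.1.2.
    apply/eqP; move: qa; rewrite inE qw /=; apply: contraNT => n.
    by apply/exists_inP; exists r; rewrite // qr eqxx.
  case: q r qw rw qr qr1 {qa ra} => [[e w] [f u]] [[e' w'] [f' u']].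
  move=> /walksP[[eH fH _] [[ve we vw] [wf uf uw]]].
  move=> /walksP[[eH' fH' _] [[ve' we' _] [wf' uf' _]]] /= uu ww; subst u' w'.
  by rewrite (linear_eq eH eH' vw ve we) // (linear_eq fH fH' uw uf wf).
have -> : #|walks v :&: ambiguous v| = #|ambiguous v|.
  by congr #|pred_of_set _|; apply/setIidPr/subsetP => q; rewrite inE => /andP[].
rewrite -sum1_card (partition_big fst (mem (flags v))) /=; last first.
  case=> -[e w] [f u]; rewrite inE => /andP[/walksP[[eH _ _] [[ve we vw] _]] _].
  by rewrite inE /= eH ve we.
rewrite mulnC -sum_nat_const; apply: leq_sum => -[e w].
rewrite inE => /and4P[eH ve we vw].
apply: leq_trans (card_ambiguous_fiber eH ve we vw).
rewrite sum1dep_card -(@card_in_imset _ _ snd) => [|[a p] [b q]].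
  apply/subset_leq_card/subsetP => _ /imsetP[[a p] ap ->] /=.
  by move: ap; rewrite inE => /andP[qa /= /eqP <-]; rewrite inE.
by rewrite !inE => /andP[_ /= /eqP->] /andP[_ /= /eqP->] /= ->.
Qed.

(** * Double counting over all starting vertices *)

Lemma sum_deg : \sum_w deg w = 3 * #|H|.
Proof.
rewrite /deg; under eq_bigr => w _ do rewrite -sum1_card big_mkcond /=.
under eq_bigr => w _ do under eq_bigr => e _ do rewrite inE.
rewrite exchange_big /= mulnC -sum_nat_const [RHS]big_mkcond /=.
apply: eq_bigr => e _; case: ifP => [eH|_] /=; last by rewrite big1.
by rewrite -(uniform_card eH) -big_mkcond sum1_card.
Qed.

(** A hyperedge through [v] offers two further vertices, so [v] has at most [2 * deg v] flags. *)
Lemma sum_flags : \sum_v #|flags v| <= 6 * #|H|.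
Proof.
have -> : 6 * #|H| = \sum_v 2 * deg v by rewrite -big_distrr sum_deg /=; lia.
apply: leq_sum => v _; rewrite mulnC -sum_nat_const -sum1_card.
rewrite (partition_big fst (mem [set e in H | v \in e])) /=; last first.
  by case=> e w; rewrite !inE => /and4P[-> ->].
apply: leq_sum => e; rewrite inE => /andP[eH ve].
rewrite sum1dep_card -(card_D1 eH ve) -(@card_in_imset _ _ snd) => [|[a p] [b q]].
  apply/subset_leq_card/subsetP => _ /imsetP[[a p] ap ->].
  move: ap; rewrite !inE => /andP[/and4P[_ _ pe vp] /= /eqP ae].
  by rewrite eq_sym vp -ae.
by rewrite !inE => /andP[_ /= /eqP->] /andP[_ /= /eqP->] /= ->.
Qed.

(** At a middle vertex [w] there are [deg w * (deg w).-1] ordered pairs of distinct hyperedges, each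
    with two choices for the start and two for the end. *)
Lemma sum_walks_ge : \sum_w 4 * (deg w * (deg w).-1) <= \sum_v #|walks v|.
Proof.
pose T := (V * (({set V} * V) * ({set V} * V)))%type.
pose Q : {set T} := [set t | t.2 \in walks t.1].
(* Pairing every walk with its start gives a single set, which can be regrouped by middle vertex,
   then by first and second hyperedge. *)
have -> : \sum_v #|walks v| = \sum_(t in Q) 1.
  rewrite (partition_big fst xpredT) //=; apply: eq_bigr => v _.
  rewrite sum1dep_card -(card_imset (mem (walks v)) (_ : injective (pair v)));
    last by move=> ? ? [].
  apply: eq_card => -[v' q]; rewrite [RHS]inE [_ \in Q]inE /=.
  apply/imsetP/andP => [[q' qw [-> ->]]|[qw /eqP <-]] //.
  by exists q.
rewrite (partition_big (fun t : T => t.2.1.2) xpredT) //=.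
apply: leq_sum => w _.
pose E := [set e in H | w \in e].
pose F e := E :\ e.
have -> : 4 * (deg w * (deg w).-1) = \sum_(e in E) \sum_(f in F e) 4.
  rewrite mulnC -mulnA -sum_nat_const; apply: eq_bigr => e eE.
  by rewrite sum_nat_const; congr (_ * _); rewrite /deg -/E (cardsD1 e) eE.
rewrite (partition_big (fun t : T => t.2.1.1) (mem E)) /=; last first.
  case=> v [[e x] [f u]]; rewrite inE /= => /andP[/walksP[[eH _ _] [[_ xe _] _]]].
  by move=> /eqP xw; rewrite inE eH -xw.
apply: leq_sum => e eE.
rewrite (partition_big (fun t : T => t.2.2.1) (mem (F e))) /=; last first.
  case=> v [[a x] [f u]]; rewrite inE /= => /andP[/andP[/walksP]].
  by case=> [[_ fH fa] [_ [xf _ _]]] /eqP xw /eqP ae; rewrite !inE -ae fa fH -xw.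
apply: leq_sum => f; rewrite !inE => /and3P[fe fH wf].
move: eE; rewrite inE => /andP[eH we].
have <- : #|setX (e :\ w) (f :\ w)| = 4 by rewrite cardsX !card_D1.
pose h (p : V * V) : T := (p.1, ((e, w), (f, p.2))).
rewrite -(@card_imset _ _ h); last by move=> [? ?] [? ?] [-> ->].
rewrite sum1dep_card; apply/subset_leq_card/subsetP => _ /imsetP[[v u] vu ->].
move: vu; rewrite !inE /= => /andP[/andP[vw ve] /andP[uw uf]].
by rewrite !eqxx eH fH fe ve we wf uf uw vw.
Qed.

Lemma C4_free_card_quadratic : 36 * #|H| ^ 2 <= #|V| * (#|V| ^ 2 + 36 * #|H|).
Proof.
have C := cauchy_sum_nat deg; rewrite sum_deg in C.
have W : \sum_v #|walks v| <= #|V| ^ 2 + 24 * #|H|.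
  apply: (@leq_trans (\sum_v (#|V| + 4 * #|flags v|))).
    by apply: leq_sum => v _; apply: card_walks_le.
  rewrite big_split /= sum_nat_const -big_distrr /=; apply: leq_add => //.
  by rewrite -[24]/(4 * 6) -mulnA leq_mul2l sum_flags.
(* From [d ^ 2 = d * d.-1 + d], also true at [d = 0]. The extra [12 * #|H|] raises the 24 of [W] to
   the final 36. *)
have S : 4 * \sum_w deg w ^ 2 = \sum_w 4 * (deg w * (deg w).-1) + 12 * #|H|.
  have -> : 12 * #|H| = \sum_w 4 * deg w by rewrite -big_distrr sum_deg /=; lia.
  rewrite -big_split big_distrr /=; apply: eq_bigr => w _.
  by case: (deg w) => //= d; lia.
have := sum_walks_ge; nia.
Qed.

End BergeC4Free.

(* Passage to the reals: solving the quadratic inequality, and asymptotics *)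
From mathcomp Require Import all_classical all_reals all_analysis.
From mathcomp Require Import ring lra.
Import Order.TTheory GRing.Theory Num.Theory.
Import numFieldNormedType.Exports.
Local Open Scope classical_set_scope.
Local Open Scope ring_scope.

(** Completing the square turns the hypothesis into [(6 * m - 3 * n) ^ 2 <= n ^ 2 * (n + 9)], read
    over the reals. *)
Lemma quadratic_sqrt_bound (R : realType) (m n : nat) :
  (36 * m ^ 2 <= n * (n ^ 2 + 36 * m))%N ->
  m%:R <= 1 / 6 * n%:R * Num.sqrt (n%:R + 9) + n%:R / 2 :> R.
Proof.
rewrite -(ler_nat R) !(natrM, natrD, natrX) => h.
have n0 : 0 <= n%:R :> R by [].
move: n%:R m%:R n0 h => x y x0 h.
suff : 6 * y - 3 * x <= x * Num.sqrt (x + 9) by lra.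
(* The absolute value is the root of the square, so the sign of [6 * y - 3 * x] need not be
   discussed. *)
apply: le_trans (ler_norm _) _.
have -> : x * Num.sqrt (x + 9) = Num.sqrt (x ^+ 2 * (x + 9)).
  by rewrite sqrtrM ?sqr_ge0 // sqrtr_sqr ger0_norm.
rewrite -sqrtr_sqr.
by rewrite ler_wsqrtr //; lra.
Qed.

(** The difference is [n] times a factor between 1/2 and 1, because the shift by 9 raises the root
    by at most 3; any constant [k >= 1] therefore works. *)
Lemma sqrt_shift_bigO (R : realType) :
  (fun n : nat => 1 / 6 * n%:R * Num.sqrt (n%:R + 9) + n%:R / 2 : R) =
    (fun n : nat => n%:R `^ (3 / 2) / 6 : R) +O_ \oo (fun n : nat => n%:R : R).
Proof.
apply/eqaddOP.
near=> k; near=> n => /=.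
change (`|1 / 6 * n%:R * Num.sqrt (n%:R + 9) + n%:R / 2 - n%:R `^ (3 / 2) / 6|
  <= k * `|n%:R : R|).
have n0 : 0 <= n%:R :> R by [].
have -> : n%:R `^ (3 / 2) = n%:R * Num.sqrt n%:R :> R.
  rewrite -powR12_sqrt // -{2}(powRr1 n0) -powRD; first by congr powR; lra.
  by apply/implyP => /eqP; lra.
have k1 : 1 <= k by near: k; exact: nbhs_pinfty_ge.
move: n%:R n0 => x x0.
have st : Num.sqrt x <= Num.sqrt (x + 9) by rewrite ler_wsqrtr //; lra.
(* Compare squares: [x + 9 <= x + 6 * Num.sqrt x + 9]. *)
have ts : Num.sqrt (x + 9) <= Num.sqrt x + 3.
  have t0 := sqrtr_ge0 x.
  rewrite -[leRHS]ger0_norm; last by lra.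
  rewrite -sqrtr_sqr ler_wsqrtr // sqrrD sqr_sqrtr //; lra.
have -> : 1 / 6 * x * Num.sqrt (x + 9) + x / 2 - x * Num.sqrt x / 6 =
  x * ((Num.sqrt (x + 9) - Num.sqrt x) / 6 + 1 / 2) by field.
rewrite normrM (ger0_norm x0) mulrC ler_wpM2r // ger0_norm; lra.
Unshelve. all: by end_near.
Qed.

Theorem theorem2 (R : realType) :
  (forall n : nat,
     (ex_lin 3 4 n)%:R <=
       1 / 6 * n%:R * Num.sqrt (n%:R + 9) + n%:R / 2 :> R) /\
  (fun n : nat => 1 / 6 * n%:R * Num.sqrt (n%:R + 9) + n%:R / 2 : R) =
    (fun n : nat => n%:R `^ (3 / 2) / 6 : R) +O_ \oo (fun n : nat => n%:R : R).
Proof.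
split; last exact: sqrt_shift_bigO.
move=> n; apply: quadratic_sqrt_bound.
(* The quadratic inequality holds at 0, the value of an empty maximum, and passes to the larger of
   two numbers, so it suffices to check each admissible [H]. *)
rewrite /ex_lin; elim/big_ind: _ => [//|a b ha hb|H /and3P[u l c]].
  by rewrite /maxn; case: ifP.
by have := C4_free_card_quadratic u l c; rewrite card_ord.
Qed.
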